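(* Let $\Phi$ be a Følner sequence on $\mathbb{N}$ and let $f\in\mathsf{Bes}(\mathbb{N},\Phi)$. For every $\epsilon>0$ there exist a Bohr$_0$ set $B$ and a subsequence $\Psi$ of $\Phi$ such that for $\Psi$-almost every ultrafilter $\mathfrak{p}\in\mathsf{cl}(B)$ we have $\|\mathsf{R}^{\mathfrak{p}}f-f\|_\Psi<\epsilon$.
   Context: A Følner sequence in $\mathbb{N}$ is a sequence $\Phi\colon N\mapsto\Phi_N$ of finite non-empty subsets of $\mathbb{N}$ with $|(\Phi_N+m)\triangle\Phi_N|/|\Phi_N|\to0$ for all $m\in\mathbb{N}$. $\|f\|_\Phi=\big(\limsup_{N\to\infty}\frac{1}{|\Phi_N|}\sum_{n\in\Phi_N}|f(n)|^2\big)^{1/2}$. A trigonometric polynomial is $n\mapsto\sum_{j=1}^Jc_je^{2\pi i\theta_jn}$ ($c_j\in\mathbb{C}$, $\theta_j\in[0,1)$); $\mathsf{Bes}(\mathbb{N},\Phi)$ is the set of $f\colon\mathbb{N}\to\mathbb{C}$ that can be approximated arbitrarily well in $\|\cdot\|_\Phi$ by trigonometric polynomials. For an ultrafilter $\mathfrak{p}$, $(\mathsf{R}^{\mathfrak{p}}f)(n)=\lim_{m\to\mathfrak{p}}f(n+m)$ (ultrafilter limit in the compactification $\mathbb{C}\cup\{\infty\}$ if $f$ is unbounded). $\beta\mathbb{N}$ is the Stone–Čech compactification (space of ultrafilters on $\mathbb{N}$, with base of clopen sets $\mathsf{cl}(A)=\{\mathfrak{p}:A\in\mathfrak{p}\}$),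 with $n$ identified with the principal ultrafilter at $n$. $\mathcal{M}(\Psi)$ is the set of Radon probability measures on $\beta\mathbb{N}$ that are weak$^*$ accumulation points of $\{\frac{1}{|\Psi_N|}\sum_{n\in\Psi_N}\delta_n: N\in\mathbb{N}\}$. A property holds for $\Psi$-almost every ultrafilter in a set $S$ if the set of ultrafilters in $S$ failing it is null for every $\mu\in\mathcal{M}(\Psi)$. A Bohr$_0$ set is a set $a^{-1}(U)$ with $a$ a homomorphism from $(\mathbb{N},+)$ into a compact metrizable abelian group $K$ and $U\subset K$ an open set containing the identity whose boundary has zero Haar measure. *)

(* Defs.v *)
From HB Require Import structures.
From mathcomp Require Import all_boot all_order all_algebra.
From mathcomp Require Import all_classical all_reals all_analysis.
From mathcomp Require Import complex finmap.
Set Implicit Arguments. Unset Strict Implicit. Unset Printing Implicit Defensive.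
Import Order.TTheory GRing.Theory Num.Theory.
Import numFieldNormedType.Exports.
Local Open Scope classical_set_scope.
Local Open Scope ring_scope.

Definition fshift (A : {fset nat}) (m : nat) : {fset nat} :=
  [fset (n + m)%N | n in A]%fset.

Definition fsymdiff (A B : {fset nat}) : {fset nat} :=
  fsetU (fsetD A B) (fsetD B A).

Definition folner (R : realType) (Phi : nat -> {fset nat}) : Prop :=
  (forall N, Phi N != fset0) /\
  forall m : nat,
    (fun N => (#|` fsymdiff (fshift (Phi N) m) (Phi N) |%:R
               / #|` Phi N |%:R : R)) @ \oo --> (0 : R).

(* The seminorm ||.||_Phi.  A "squared modulus" sequence h n = |g(n)|^2 is
   given in the extended reals, so that the value +oo (from the point at
   infinity of C u {oo}) is allowed.                                  *)

Definition avgE (R : realType) (Phi : nat -> {fset nat}) (h : nat -> \bar R)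
    (N : nat) : \bar R :=
  ((#|` Phi N |%:R)^-1 : R)%:E * (\sum_(n <- Phi N) h n)%E.

Definition besnormE (R : realType) (Phi : nat -> {fset nat}) (h : nat -> \bar R)
  : \bar R := sqrte (limn_esup (avgE Phi h)).

Definition sqmod (R : realType) (g : nat -> R[i]) : nat -> \bar R :=
  fun n => ((Normc.normc (g n)) ^+ 2)%:E.

Definition besnorm (R : realType) (Phi : nat -> {fset nat}) (g : nat -> R[i])
  : \bar R := besnormE Phi (sqmod g).

Definition cexp2pi (R : realType) (x : R) : R[i] :=
  Complex (cos (2 * pi * x)) (sin (2 * pi * x)).

Definition trigpoly (R : realType) (P : nat -> R[i]) : Prop :=
  exists (J : nat) (c : nat -> R[i]) (theta : nat -> R),
    (forall j, 0 <= theta j < 1) /\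
    forall n : nat, P n = \sum_(j < J) c j * cexp2pi (theta j * n%:R).

Definition Bes (R : realType) (Phi : nat -> {fset nat}) (f : nat -> R[i]) : Prop :=
  forall e : R, 0 < e ->
    exists P, trigpoly P /\ (besnorm Phi (fun n => (f n - P n)%R) < e%:E)%E.

Definition betaN := {F : set_system nat | UltraFilter F}.

Definition cl (A : set nat) : set betaN := [set p | proj1_sig p A].

Definition bopen : set (set betaN) :=
  [set O | forall p, O p -> exists A : set nat, cl A p /\ cl A `<=` O].

Definition bcompact (K : set betaN) : Prop :=
  forall (I : Type) (O : I -> set betaN),
    (forall i, bopen (O i)) -> K `<=` \bigcup_i O i ->
    exists D : set I, finite_set D /\ K `<=` \bigcup_(i in D) O i.

Definition bcontinuous (R : realType) (g : betaN -> R) : Prop :=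
  forall V : set R, open V -> bopen (g @^-1` V).

Definition pt (n : nat) : betaN :=
  exist _ (principal_filter n) (principal_filter_ultra n).

HB.instance Definition _ := gen_eqMixin betaN.
HB.instance Definition _ := gen_choiceMixin betaN.
HB.instance Definition _ := isPointed.Build betaN (pt 0).

Definition BN := g_sigma_algebraType bopen.

(* Radon = inner regular by compact sets (for finite Borel measures on a
   compact Hausdorff space this is the usual notion) *)
Definition radon (R : realType) (mu : probability BN R) : Prop :=
  forall E : set BN, measurable E ->
    mu E = ereal_sup [set mu K | K in
                       [set K : set BN | measurable K /\ bcompact K /\ K `<=` E]].

(* integral of g against (1/|Phi_N|) sum_{n in Phi_N} delta_n *)
Definition emp_avg (R : realType) (Phi : nat -> {fset nat}) (N : nat)
    (g : betaN -> R) : R :=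
  (#|` Phi N |%:R)^-1 * \sum_(n <- Phi N) g (pt n).

(* mu is a weak-* accumulation (cluster) point of the sequence of empirical
   measures: every basic weak-* neighbourhood of mu (given by finitely many
   continuous functions and a tolerance) contains the N-th empirical measure
   for arbitrarily large N. *)
Definition wstar_cluster (R : realType) (Phi : nat -> {fset nat})
    (mu : probability BN R) : Prop :=
  forall (k : nat) (g : nat -> betaN -> R) (e : R),
    (forall i, (i < k)%N -> bcontinuous (g i)) -> 0 < e ->
    forall N0 : nat, exists N : nat, (N0 <= N)%N /\
      forall i, (i < k)%N ->
        (`| (emp_avg Phi N (g i))%:E - \int[mu]_x ((g i x)%:E) | < e%:E)%E.

Definition inM (R : realType) (Phi : nat -> {fset nat}) (mu : probability BN R)
  : Prop := radon mu /\ wstar_cluster Phi mu.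

(* Ultrafilter limits in C u {oo} (None stands for oo) and R^p f.     *)

Definition is_ulim (R : realType) (p : set_system nat) (u : nat -> R[i])
    (l : option R[i]) : Prop :=
  match l with
  | Some z => forall e : R, 0 < e -> p [set m | Normc.normc (u m - z) < e]
  | None => forall M : R, p [set m | M < Normc.normc (u m)]
  end.

Definition Rp (R : realType) (p : betaN) (f : nat -> R[i]) (n : nat) : option R[i] :=
  xget None [set l | is_ulim (proj1_sig p) (fun m => f (n + m)%N) l].

Definition sqmod_Rp_sub (R : realType) (p : betaN) (f : nat -> R[i]) : nat -> \bar R :=
  fun n => match Rp p f n with
           | Some z => ((Normc.normc (z - f n)) ^+ 2)%:E
           | None => +oo%E
           end.

Definition besnorm_Rp_sub (R : realType) (Phi : nat -> {fset nat}) (p : betaN)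
    (f : nat -> R[i]) : \bar R := besnormE Phi (sqmod_Rp_sub p f).

Definition metrizable (R : realType) (K : topologicalType) : Prop :=
  exists d : K -> K -> R,
    (forall x y, d x y = 0 <-> x = y) /\
    (forall x y, d x y = d y x) /\
    (forall x y z, d x z <= d x y + d y z) /\
    (forall A : set K, open A <->
       (forall x, A x -> exists2 e : R, 0 < e & [set y | d x y < e] `<=` A)).

(* K, pointed by 0, so that its Borel sigma-algebra can be formed *)
Definition ptK (K : topologicalZmodType) : Type := K.
HB.instance Definition _ (K : topologicalZmodType) := Choice.on (ptK K).
HB.instance Definition _ (K : topologicalZmodType) := isPointed.Build (ptK K) (0 : K).

Definition openK (K : topologicalZmodType) : set (set (ptK K)) :=
  [set A | @open K A].

(* Haar measure on K: a translation-invariant Borel probability measure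
   (it exists and is unique on a compact metrizable abelian group).
   S is Haar-null iff it is null for it. *)
Definition haar_null (R : realType) (K : topologicalZmodType) (S : set K) : Prop :=
  forall mu : probability (g_sigma_algebraType (@openK K)) R,
    (forall (x : K) (A : set (g_sigma_algebraType (@openK K))), measurable A ->
       mu [set (x + (y : K)) | y in A] = mu A) ->
    mu (S : set (ptK K)) = 0%E.

Definition bohr0 (R : realType) (B : set nat) : Prop :=
  exists (K : topologicalZmodType) (a : nat -> K) (U : set K),
    [/\ compact [set: K] /\ metrizable R K,
        (forall m n : nat, a (m + n)%N = a m + a n),
        open U /\ U 0,
        haar_null R (closure U `\` interior U) &
        B = a @^-1` U].

(* Main.v *)
(** Write [P_N] for trigonometric polynomials with [||f - P_N||^2 < eta/2^(N+2)],
    [Q] for one with [||f - Q||^2 < eta], and let the Bohr set [B] consist of the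
    [m] that move [Q] by at most [sqrt eta] uniformly.

    Averages of a trigonometric polynomial along a Folner sequence converge
    uniformly over all translates, so [Psi_N = Phi_(s N)] can be chosen with
    [avg_(Psi_N) |P_N - Q|^2(. + m) < 5 eta] for every [m] at once.  Let [A_N] be
    the set of [m] with [avg_(Psi_N) |f - P_N|^2(. + m) > eta].  By Markov's
    inequality and the Folner property its density along [Phi] is at most
    [2^-(N+1)], hence so is [mu (cl A_N)] for every [mu] in [M(Psi)], and by
    Borel-Cantelli almost every [p] contains the complement of [A_N] for all
    large [N].  For [m] in [B] outside [A_N], going through [P_N(. + m)],
    [Q(. + m)], [Q] gives [avg_(Psi_N) |f(. + m) - f|^2 <= 32 eta], and this
    finite estimate survives the limit [m -> p] even when [f] is unbounded. *)

Require Import Defs.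
From HB Require Import structures.
From mathcomp Require Import all_boot all_order all_algebra.
From mathcomp Require Import all_classical all_reals all_analysis.
From mathcomp Require Import complex finmap.
From mathcomp Require Import ring lra.
Import Order.TTheory GRing.Theory Num.Theory.
Import numFieldNormedType.Exports.
Local Open Scope classical_set_scope.
Local Open Scope ring_scope.
Set Implicit Arguments.
Unset Strict Implicit.
Unset Printing Implicit Defensive.

(** * Averages along Folner sequences *)

Definition avg (R : realType) (S : {fset nat}) (u : nat -> R) : R :=
  (#|` S |%:R)^-1 * \sum_(n <- S) u n.

Definition shift_defect (R : realType) (S : {fset nat}) (m : nat) : R :=
  #|` fsymdiff (fshift S m) S |%:R / #|` S |%:R.

Lemma card_fset_gt0 (R : realType) (S : {fset nat}) :
  S != fset0 -> 0 < #|` S |%:R :> R.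
Proof. by move=> S0; rewrite ltr0n cardfs_gt0. Qed.

Lemma avgD (R : realType) (S : {fset nat}) (u v : nat -> R) :
  avg S (fun n => u n + v n) = avg S u + avg S v.
Proof. by rewrite /avg big_split mulrDr. Qed.

Lemma avgZ (R : realType) (S : {fset nat}) (a : R) (u : nat -> R) :
  avg S (fun n => a * u n) = a * avg S u.
Proof. by rewrite /avg -mulr_sumr mulrCA. Qed.

Lemma avg_cst (R : realType) (S : {fset nat}) (a : R) :
  S != fset0 -> avg S (fun=> a) = a.
Proof.
move=> /(card_fset_gt0 R) S0; rewrite /avg big_const_seq count_predT iter_addr_0.
by rewrite -(@mulr_natl R a) mulrA mulVf ?mul1r // gt_eqF.
Qed.

Lemma ler_avg (R : realType) (S : {fset nat}) (u v : nat -> R) :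
  {in S, forall n, u n <= v n} -> avg S u <= avg S v.
Proof.
move=> uv; rewrite /avg ler_wpM2l ?invr_ge0 ?ler0n // big_seq [leRHS]big_seq.
exact: ler_sum.
Qed.

Lemma exchange_avg (R : realType) (S T : {fset nat}) (F : nat -> nat -> R) :
  avg S (fun m => avg T (fun n => F n m)) = avg T (fun n => avg S (F n)).
Proof.
by rewrite /avg -!mulr_sumr exchange_big mulrCA.
Qed.

Lemma sum_fshift (R : realType) (S : {fset nat}) (m : nat) (u : nat -> R) :
  \sum_(n <- fshift S m) u n = \sum_(n <- S) u (n + m)%N.
Proof.
rewrite /fshift big_imfset //= => x y _ _; exact: addIn.
Qed.

(** The terms over the intersection cancel, leaving the two disjoint halves of the symmetric
    difference. *)
Lemma sum_fsetD_le (R : realType) (A B : {fset nat}) (u : nat -> R) (T : R) :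
  (forall n, `|u n| <= T) ->
  `|\sum_(n <- A) u n - \sum_(n <- B) u n| <= T * #|` fsymdiff A B |%:R.
Proof.
move=> uT.
have bd (S : {fset nat}) : `|\sum_(n <- S) u n| <= T * #|` S |%:R.
  apply: (le_trans (ler_norm_sum _ _ _)).
  apply: (@le_trans _ _ (\sum_(n <- S) T)); first exact: ler_sum.
  by rewrite big_const_seq count_predT iter_addr_0 mulr_natr.
rewrite (big_fsetID _ (mem B)) //= [X in _ - X](big_fsetID _ (mem A)) //=.
have -> : [fset x | x in A & x \in B]%fset = [fset x | x in B & x \in A]%fset.
  by apply/fsetP => x; rewrite !inE andbC.
rewrite opprD addrACA subrr add0r.
have -> : [fset x | x in A & x \notin B]%fset = (A `\` B)%fset.
  by apply/fsetP => x; rewrite !inE andbC.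
have -> : [fset x | x in B & x \notin A]%fset = (B `\` A)%fset.
  by apply/fsetP => x; rewrite !inE andbC.
apply: (le_trans (ler_normB _ _)).
apply: (le_trans (lerD (bd _) (bd _))).
rewrite -mulrDr -natrD /fsymdiff cardfsU.
suff -> : ((A `\` B) `&` (B `\` A))%fset = fset0 by rewrite cardfs0 subn0.
by apply/fsetP => x; rewrite !inE; case: (x \in A); case: (x \in B).
Qed.

(** Quantitative form of the Folner property for bounded functions. The bound depends on [u] only
    through [T], which later gives uniformity over translates. *)
Lemma avg_shift_le (R : realType) (S : {fset nat}) (m : nat) (u : nat -> R) (T : R) :
  (forall n, `|u n| <= T) ->
  `|avg S (fun n => u (n + m)%N) - avg S u| <= T * shift_defect R S m.
Proof.
move=> uT; rewrite /avg -sum_fshift -mulrBr normrM ger0_norm ?invr_ge0 ?ler0n //.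
rewrite /shift_defect mulrA mulrC ler_wpM2r ?invr_ge0 ?ler0n //.
exact: sum_fsetD_le.
Qed.

Lemma folner_defect (R : realType) (Phi : nat -> {fset nat}) (m : nat) (e : R) :
  folner R Phi -> 0 < e -> \forall M \near \oo, shift_defect R (Phi M) m < e.
Proof.
move=> [_ /(_ m) /cvgr0Pnorm_lt H] e0; near=> M.
rewrite -[X in X < _]ger0_norm; last exact: divr_ge0.
by near: M; exact: H.
Unshelve. all: by end_near. Qed.

(** * Uniform averages of trigonometric polynomials *)

(** Real trigonometric polynomials. The phase [be] covers sines and absorbs translations of [n], and
    the inductive form lets averages be treated one cosine at a time. *)
Inductive rtrig (R : realType) : (nat -> R) -> Prop :=
| rtrig_cos (a al be : R) : rtrig (fun n => a * cos (al * n%:R + be))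
| rtrig_add u v : rtrig u -> rtrig v -> rtrig (fun n => u n + v n).

Lemma rtrig_ext (R : realType) (u v : nat -> R) : u =1 v -> rtrig u -> rtrig v.
Proof. by move=> /funext ->. Qed.

Lemma rtrig_sum (R : realType) (I : Type) (r : seq I) (F : I -> nat -> R) :
  (forall j, rtrig (F j)) -> rtrig (fun n => \sum_(j <- r) F j n).
Proof.
move=> rF; elim: r => [|j r IH].
  apply: rtrig_ext (rtrig_cos 0 0 0) => n; by rewrite big_nil mul0r.
by apply: rtrig_ext (rtrig_add (rF j) IH) => n; rewrite big_cons.
Qed.

(** By bilinearity it suffices to multiply two cosines, where the product-to-sum formula applies. *)
Lemma rtrig_mul (R : realType) (u v : nat -> R) :
  rtrig u -> rtrig v -> rtrig (fun n => u n * v n).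
Proof.
move=> ru; elim: ru v => {u} [a al be v|u1 u2 _ IH1 _ IH2 v rv]; last first.
  by apply: rtrig_ext (rtrig_add (IH1 _ rv) (IH2 _ rv)) => n; rewrite mulrDl.
elim=> {v} [a' al' be'|u1 u2 _ IH1 _ IH2]; last first.
  by apply: rtrig_ext (rtrig_add IH1 IH2) => n; rewrite mulrDr.
apply: rtrig_ext (rtrig_add (rtrig_cos (a * a' / 2) (al + al') (be + be'))
  (rtrig_cos (a * a' / 2) (al - al') (be - be'))) => n.
set x := al * n%:R + be; set y := al' * n%:R + be'.
have -> : (al + al') * n%:R + (be + be') = x + y by rewrite /x /y; ring.
have -> : (al - al') * n%:R + (be - be') = x - y by rewrite /x /y; ring.
by rewrite cosD cosB; field.
Qed.

(* Telescoping: 2 sin(al/2) cos(al n + be) = g (n+1) - g n with g a sine, and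
   if sin(al/2) = 0 then the cosine is constant in [n]. *)
Lemma avg_cos_shift (R : realType) (Phi : nat -> {fset nat}) (al be : R) :
  folner R Phi -> exists c : R, forall e : R, 0 < e ->
  \forall M \near \oo, forall m,
    `|avg (Phi M) (fun n => cos (al * (n + m)%:R + be)) - c| < e.
Proof.
move=> Fo; have [s0|s0] := eqVneq (sin (al / 2)) 0.
  exists (cos be) => e e0; near=> M => m.
  have c1 : cos al = 1.
    rewrite [al]splitr cosD -!expr2 cos2sin2 s0; ring.
  have s1 : sin al = 0 by rewrite [al]splitr sinD s0; ring.
  have cn n : cos (al * n%:R + be) = cos be.
    elim: n => [|n IH]; first by rewrite mulr0 add0r.
    have -> : al * n.+1%:R + be = (al * n%:R + be) + al by rewrite -natr1; ring.
    by rewrite cosD c1 s1 IH; ring.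
  have -> : (fun n => cos (al * (n + m)%:R + be)) = fun=> cos be.
    by apply/funext => n; rewrite cn.
  by rewrite avg_cst ?subrr ?normr0 //; case: Fo.
exists 0 => e e0.
have k0 : 0 < `|2 * sin (al / 2)| by rewrite normr_gt0 mulf_neq0.
near=> M => m; rewrite subr0.
pose g (n : nat) : R := sin (al * n%:R + (al * m%:R + be - al / 2)).
have gE n : cos (al * (n + m)%:R + be) = (2 * sin (al / 2))^-1 * (g (n + 1)%N + (-1) * g n).
  have Ds : (2 * sin (al / 2)) != 0 by rewrite mulf_neq0.
  apply: (mulfI Ds); rewrite mulVKf //.
  rewrite /g !natrD.
  set x := al * (n%:R + m%:R) + be.
  have -> : al * (n%:R + 1) + (al * m%:R + be - al / 2) = x + al / 2 by rewrite /x; field.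
  have -> : al * n%:R + (al * m%:R + be - al / 2) = x - al / 2 by rewrite /x; field.
  rewrite sinD sinB; ring.
have -> : (fun n => cos (al * (n + m)%:R + be)) =
   fun n => (2 * sin (al / 2))^-1 * (g (n + 1)%N + (-1) * g n) by exact/funext.
rewrite avgZ avgD avgZ mulN1r normrM.
have g1 n : `|g n| <= 1 by exact: sin_max.
(* The telescoped average compares [g] with its shift by 1. Since [m] enters only the phase of [g],
   the resulting bound is free of [m]. *)
apply: le_lt_trans (_ : `|(2 * sin (al / 2))^-1| * shift_defect R (Phi M) 1 < e).
  by rewrite ler_wpM2l // -[leRHS]mul1r; exact: avg_shift_le.
rewrite normfV mulrC ltr_pdivrMr //.
by near: M; exact: folner_defect Fo (mulr_gt0 e0 k0).
Unshelve. all: by end_near. Qed.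

Lemma rtrig_avg_shift (R : realType) (Phi : nat -> {fset nat}) (u : nat -> R) :
  folner R Phi -> rtrig u -> exists c : R, forall e : R, 0 < e ->
  \forall M \near \oo, forall m,
    `|avg (Phi M) (fun n => u (n + m)%N) - c| < e.
Proof.
move=> Fo; elim=> {u} [a al be|u v _ [c Hc] _ [d Hd]].
  have [c Hc] := avg_cos_shift al be Fo; exists (a * c) => e e0.
  (* Adding 1 keeps the divisor positive when [a] vanishes. *)
  have a0 : 0 < `|a| + 1 by apply: ltr_wpDl.
  have /Hc H : 0 < e / (`|a| + 1) by exact: divr_gt0.
  near=> M => m.
  rewrite avgZ -mulrBr normrM.
  have : `|avg (Phi M) (fun n => cos (al * (n + m)%:R + be)) - c| < e / (`|a| + 1).
    by move: m; near: M; exact: H.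
  rewrite ltr_pdivlMr //; apply: le_lt_trans.
  by rewrite mulrC ler_wpM2l // ler_wpDr.
exists (c + d) => e e0.
have e2 : 0 < e / 2 by lra.
near=> M => m.
rewrite avgD.
have -> : forall x y, x + y - (c + d) = (x - c) + (y - d) :> R by move=> x y; ring.
rewrite (le_lt_trans (ler_normD _ _)) // [e]splitr ltrD //.
  move: m; near: M; exact: Hc.
move: m; near: M; exact: Hd.
Unshelve. all: by end_near. Qed.

(** The averages at translates [m] and 0 are both within [e / 2] of the same limit [c], so a bound
    on the untranslated average carries over to all translates at once. *)
Lemma rtrig_avg_shift_lt (R : realType) (Phi : nat -> {fset nat}) (u : nat -> R)
    (k : R) : folner R Phi -> rtrig u ->
  (\forall M \near \oo, avg (Phi M) u < k) -> forall e, 0 < e ->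
  \forall M \near \oo, forall m, avg (Phi M) (fun n => u (n + m)%N) < k + e.
Proof.
move=> Fo ru uk e e0; have [c Hc] := rtrig_avg_shift Fo ru.
have e2 : 0 < e / 2 by lra.
near=> M => m.
have H : forall m, `|avg (Phi M) (fun n => u (n + m)%N) - c| < e / 2.
  by near: M; exact: Hc.
have := H m; have := H 0%N.
have -> : (fun n => u (n + 0)%N) = u by apply/funext => n; rewrite addn0.
have : avg (Phi M) u < k by near: M.
rewrite !ltr_norml; lra.
Unshelve. all: by end_near. Qed.

(** * Real and imaginary parts of complex trigonometric polynomials *)

Lemma normc_sqr (R : realType) (z : R[i]) :
  Normc.normc z ^+ 2 = complex.Re z ^+ 2 + complex.Im z ^+ 2.
Proof. by case: z => a b /=; rewrite sqr_sqrtr // addr_ge0 ?sqr_ge0. Qed.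

Lemma rtrig_affine (R : realType) (a b : R) (u v : nat -> R) :
  rtrig u -> rtrig v -> rtrig (fun n => a * u n + b * v n).
Proof.
have cst x : rtrig (fun=> x : R).
  apply: rtrig_ext (rtrig_cos x 0 0) => n.
  by rewrite mul0r addr0 cos0 mulr1.
by move=> ru rv; apply: rtrig_add; apply: rtrig_mul => //; exact: cst.
Qed.

Lemma trigpoly_rtrig (R : realType) (P : nat -> R[i]) :
  trigpoly P -> rtrig (fun n => complex.Re (P n)) /\ rtrig (fun n => complex.Im (P n)).
Proof.
move=> [J [c [th [_ PE]]]].
have rc (a b t : R) : rtrig (fun n : nat =>
    a * cos (2 * pi * (t * n%:R)) + b * sin (2 * pi * (t * n%:R))).
  apply: rtrig_affine.
    apply: rtrig_ext (rtrig_cos 1 (2 * pi * t) 0) => n.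
    by rewrite mul1r addr0 mulrA.
  apply: rtrig_ext (rtrig_cos 1 (2 * pi * t) (- (pi / 2))) => n.
  by rewrite mul1r cosBpihalf mulrA.
have [ReE ImE] : (forall n, complex.Re (P n) = \sum_(j < J)
      (complex.Re (c j) * cos (2 * pi * (th j * n%:R)) + (- complex.Im (c j)) * sin (2 * pi * (th j * n%:R))))
   /\ (forall n, complex.Im (P n) = \sum_(j < J)
      (complex.Im (c j) * cos (2 * pi * (th j * n%:R)) + complex.Re (c j) * sin (2 * pi * (th j * n%:R)))).
  split=> n; rewrite PE raddf_sum; apply: eq_bigr => j _;
    by case: (c j) => a b /=; ring.
by rewrite (funext ReE) (funext ImE); split; apply: rtrig_sum.
Qed.

Lemma trigpoly_sub_rtrig (R : realType) (P Q : nat -> R[i]) :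
  trigpoly P -> trigpoly Q -> rtrig (fun n => Normc.normc (P n - Q n) ^+ 2).
Proof.
move=> /trigpoly_rtrig [rP iP] /trigpoly_rtrig [rQ iQ].
have rr := rtrig_affine 1 (-1) rP rQ; have ii := rtrig_affine 1 (-1) iP iQ.
apply: rtrig_ext (rtrig_add (rtrig_mul rr rr) (rtrig_mul ii ii)) => n.
by rewrite normc_sqr; case: (P n) (Q n) => a b [c d] /=; ring.
Qed.

(** * Density of superlevel sets *)

Lemma filter_seq (T : eqType) (U : Type) (F : set_system U) (s : seq T)
    (P : T -> U -> Prop) : Filter F ->
  {in s, forall x, F (P x)} -> F [set y | {in s, forall x, P x y}].
Proof.
move=> FF; elim: s => [|x s IH] HP; first exact: filterS filterT.
have /IH H : {in s, forall z, F (P z)}.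
  by move=> z zs; apply: HP; rewrite inE zs orbT.
apply: filterS (filterI (HP x (mem_head _ _)) H) => y [Px Ps] z.
by rewrite inE => /predU1P[->|/Ps].
Qed.

(* Markov's inequality in [m]; truncating [h] at [eta * #|S|] does not change
   the superlevel set and makes the Folner property applicable. *)
Lemma superlevel_density (R : realType) (Phi : nat -> {fset nat}) (h : nat -> R)
    (S : {fset nat}) (k eta : R) :
  folner R Phi -> (forall n, 0 <= h n) -> S != fset0 -> 0 < eta -> 0 < k ->
  (\forall M \near \oo, avg (Phi M) h < k) ->
  \forall M \near \oo,
    avg (Phi M) (\1_[set m | eta < avg S (fun n => h (n + m)%N)]) <= 2 * k / eta.
Proof.
move=> Fo h0 S0 eta0 k0 hk.
have cS := card_fset_gt0 R S0.
pose T := eta * #|` S |%:R; have T0 : 0 < T by exact: mulr_gt0.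
pose hT n := Order.min (h n) T.
have hT0 n : 0 <= hT n by rewrite le_min h0 ltW.
have hTT n : hT n <= T by rewrite ge_min lexx orbT.
have hTh n : hT n <= h n by rewrite ge_min lexx.
set A := [set m | _].
(* Pointwise Markov bound. On [A], either truncation changes no value and the average still exceeds
   [eta], or one truncated value [T = eta * #|S|] alone brings the average up to [eta]. *)
have indA m : \1_A m <= eta^-1 * avg S (fun n => hT (n + m)%N).
  rewrite indicE; have [/set_mem mA|_] := boolP (m \in A); last first.
    rewrite mulr_ge0 ?invr_ge0 ?(ltW eta0) // /avg mulr_ge0 ?invr_ge0 ?ler0n //.
    exact: sumr_ge0.
  rewrite ler_pdivlMl // mulr1.
  have [/allP hall|/allPn [n nS]] := boolP (all (fun n => h (n + m)%N <= T) S).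
    apply: (le_trans (ltW mA)); apply: ler_avg => n nS.
    by rewrite /hT le_min lexx hall.
  rewrite -ltNge => hn.
  rewrite /avg ler_pdivlMl // mulrC -/T.
  rewrite (big_fsetD1 n) //= -[leLHS]addr0 lerD ?sumr_ge0 //.
  by rewrite /hT le_min lexx ltW.
have ndS : \forall M \near \oo, {in S, forall n, shift_defect R (Phi M) n < k / T}.
  by apply: filter_seq => n _; exact: folner_defect Fo (divr_gt0 k0 T0).
near=> M.
have PM : Phi M != fset0 by case: Fo.
have dS : {in S, forall n, shift_defect R (Phi M) n < k / T} by near: M.
apply: (@le_trans _ _ (eta^-1 * avg (Phi M) (fun m => avg S (fun n => hT (n + m)%N)))).
  by rewrite -avgZ; apply: ler_avg => m _; exact: indA.
rewrite [2 * k / eta]mulrC ler_wpM2l ?invr_ge0 ?(ltW eta0) //.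
(* After the exchange, each [n] in [S] contributes the average of a shift of [hT]. It differs from
   the average of [hT] by at most [T * (k / T) = k], and that average is itself at most [k], whence
   [2 * k]. *)
rewrite exchange_avg -[leRHS](avg_cst (2 * k) S0); apply: ler_avg => n nS.
have := @avg_shift_le _ (Phi M) n hT T.
have -> : (fun m => hT (n + m)%N) = fun m => hT (m + n)%N.
  by apply/funext => m; rewrite addnC.
move=> /(_ (fun n => _)) H.
have {}H : `|avg (Phi M) (fun m => hT (m + n)%N) - avg (Phi M) hT| <= k.
  apply: le_trans (H _) _; first by move=> j; rewrite ger0_norm.
  by rewrite mulrC -ler_pdivlMr // ltW // dS.
have h1 : avg (Phi M) hT <= k.
  apply: (@le_trans _ _ (avg (Phi M) h)); first exact: ler_avg.
  by apply: ltW; near: M.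
by move: H; rewrite ler_norml => /andP[_ H]; lra.
Unshelve. all: by end_near. Qed.

(** * Ultrafilter limits *)

Lemma normc_nneg (R : realType) (z : R[i]) : 0 <= Normc.normc z.
Proof. by case: z => a b; exact: sqrtr_ge0. Qed.

Lemma normc_sqrD2 (R : realType) (y z : R[i]) :
  Normc.normc (y + z) ^+ 2 <= 2 * (Normc.normc y ^+ 2 + Normc.normc z ^+ 2).
Proof.
by rewrite !normc_sqr; case: y z => a b [c d] /=;
have := sqr_ge0 (a - c); have := sqr_ge0 (b - d); nra.
Qed.

(** The image of [p] clusters at some [z] in the compact interval [[-C, C]]; were a neighbourhood of
    [z] not [p]-large, its complement would be, contradicting clustering. The index type is
    arbitrary so that the result also serves for compactness of the torus. *)
Lemma ultra_lim (R : realType) (T : Type) (p : set_system T) (v : T -> R) (C : R)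
    (D : set T) : UltraFilter p -> p D -> (forall m, D m -> `|v m| <= C) ->
  exists z, forall e, 0 < e -> p [set m | `|v m - z| < e].
Proof.
move=> pU pD vC; have pP : ProperFilter p by apply: ultra_proper.
have pC : (v @ p) `[- C, C]%classic.
  rewrite /fmap /=; apply: (@filterS _ _ _ D) => // m Dm /=.
  by rewrite in_itv /= -ler_norml; exact: vC.
have [z [_ vz]] := @segment_compact R (- C) C (v @ p) _ pC.
exists z => e e0; have [//|nb] := in_ultra_setVsetC [set m | `|v m - z| < e] pU.
have vnb : (v @ p) [set y | ~ `|y - z| < e] by [].
have [y [/= yn]] := vz _ _ vnb (nbhsx_ballx z e e0).
by rewrite /ball /= distrC => /yn.
Qed.

Lemma ultra_climit (R : realType) (T : Type) (p : set_system T) (u : T -> R[i])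
    (C : R) (D : set T) : UltraFilter p -> p D ->
  (forall m, D m -> Normc.normc (u m) <= C) ->
  exists z, forall e, 0 < e -> p [set m | Normc.normc (u m - z) < e].
Proof.
move=> pU pD uC; have pP : ProperFilter p by apply: ultra_proper.
have [|x Hx] := @ultra_lim _ _ _ (fun m => complex.Re (u m)) C _ pU pD.
  move=> m /uC; apply: le_trans; rewrite -[leRHS]ger0_norm ?normc_nneg // -ler_sqr ?nnegrE //.
  by rewrite !real_normK ?num_real // normc_sqr lerDl sqr_ge0.
have [|y Hy] := @ultra_lim _ _ _ (fun m => complex.Im (u m)) C _ pU pD.
  move=> m /uC; apply: le_trans; rewrite -[leRHS]ger0_norm ?normc_nneg // -ler_sqr ?nnegrE //.
  by rewrite !real_normK ?num_real // normc_sqr lerDr sqr_ge0.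
exists (Complex x y) => e e0 /=.
have e2 : 0 < e / 2 by exact: divr_gt0.
apply: filterS (filterI (Hx _ e2) (Hy _ e2)) => m /= [ltx lty].
rewrite -(ltr_pXn2r (n := 2)) // ?nnegrE ?normc_nneg ?(ltW e0) // normc_sqr.
case: (u m) ltx lty => a b /=.
rewrite !ltr_norml => /andP[h1 h2] /andP[h3 h4].
have : (a - x) ^+ 2 < e ^+ 2 / 4 by nra.
have : (b - y) ^+ 2 < e ^+ 2 / 4 by nra.
nra.
Qed.

(** A bound on a finite average bounds each of its terms, so for [n] in [Psi N] the values
    [f (n + m)] stay bounded on [D] and their limits are finite. A single [m] in [D] then brings all
    these finitely many values close to their limits. *)
Lemma avgE_Rp_sub_le (R : realType) (Psi : nat -> {fset nat}) (N : nat) (p : betaN)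
    (f : nat -> R[i]) (C : R) (D : set nat) :
  Psi N != fset0 -> 0 < C -> proj1_sig p D ->
  (forall m, D m ->
    avg (Psi N) (fun n => Normc.normc (f (n + m)%N - f n) ^+ 2) <= C) ->
  (avgE Psi (sqmod_Rp_sub p f) N <= (3 * C)%:E)%E.
Proof.
case: p => p pU S0 C0 /= pD; set S := Psi N => DC.
have pP : ProperFilter p by apply: ultra_proper.
have cS := card_fset_gt0 R S0.
have fC m n : D m -> n \in S -> Normc.normc (f (n + m)%N - f n) ^+ 2 <= C * #|` S |%:R.
  move=> /DC; rewrite /avg ler_pdivrMl // mulrC => H nS; apply: le_trans H.
  by rewrite (big_fsetD1 n) //= lerDl sumr_ge0 // => i _; exact: sqr_ge0.
set q : betaN := exist _ p pU.
have lim n : n \in S -> exists2 z, Rp q f n = Some z & is_ulim p (fun m => f (n + m)%N) (Some z).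
  move=> nS; set K := 2 * (C * #|` S |%:R + Normc.normc (f n) ^+ 2).
  (* [K] bounds the squared modulus, and [2 * x <= 1 + x ^+ 2] turns this into a bound on the
     modulus. *)
  have fK m : D m -> Normc.normc (f (n + m)%N) <= 1 + K.
    move=> Dm; have H : Normc.normc (f (n + m)%N) ^+ 2 <= K.
      rewrite -[f (n + m)%N](subrK (f n)).
      by apply: (le_trans (normc_sqrD2 _ _)); rewrite ler_pM2l // lerD2r; exact: fC.
    have := sqr_ge0 (Normc.normc (f (n + m)%N) - 1); nra.
  have [l ul] := @ultra_climit R _ p (fun m => f (n + m)%N) _ D pU pD fK.
  (* A limit exists, so [Rp] picks a genuine one; [None] is excluded because the values on [D] do
     not exceed [1 + K]. *)
  have := @xgetPex _ None [set l | is_ulim p (fun m => f (n + m)%N) l].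
  rewrite -/(Rp q f n) /=; case: (Rp q f n) => [z|] H; first by exists z => //; apply: H; exists (Some l).
  have /(_ (1 + K)) {}H := H (ex_intro _ (Some l) ul).
  have [m [Dm /=]] := filter_ex (filterI pD H).
  by rewrite ltNge fK.
pose z n := odflt 0 (Rp q f n).
have zE n : n \in S -> sqmod_Rp_sub q f n = (Normc.normc (z n - f n) ^+ 2)%:E.
  by move=> /lim[x E _]; rewrite /sqmod_Rp_sub /z E.
have -> : avgE Psi (sqmod_Rp_sub q f) N = (avg S (fun n => Normc.normc (z n - f n) ^+ 2))%:E.
  rewrite /avgE /avg EFinM -sumEFin; congr (_ * _)%E.
  by rewrite big_seq [RHS]big_seq; apply: eq_bigr => n /zE.
(* With this radius twice the squared error is at most [C]; the average over [D] adds [2 * C], for a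
   total of [3 * C]. *)
have r0 : 0 < Num.sqrt (C / 2) by rewrite sqrtr_gt0 divr_gt0.
have : p [set m | {in S, forall n, Normc.normc (f (n + m)%N - z n) < Num.sqrt (C / 2)}].
  apply: filter_seq => n /lim[x E H]; rewrite /z E; exact: H.
move=> /(filterI pD)/filter_ex[m [Dm /= zm]].
rewrite lee_fin.
apply: (@le_trans _ _ (avg S (fun n => C + 2 * Normc.normc (f (n + m)%N - f n) ^+ 2))).
  apply: ler_avg => n nS.
  have -> : z n - f n = - (f (n + m)%N - z n) + (f (n + m)%N - f n) by ring.
  apply: (le_trans (normc_sqrD2 _ _)); rewrite normcN mulrDr lerD2r.
  have := zm n nS; rewrite -(ltr_pXn2r (n := 2)) // ?nnegrE ?normc_nneg ?sqrtr_ge0 //.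
  by rewrite sqr_sqrtr ?divr_ge0 ?(ltW C0) //; lra.
rewrite avgD avg_cst // avgZ.
by have := DC m Dm; lra.
Qed.

(** * The torus *)

Lemma normc_dist_triangle (R : realType) (x y z : R[i]) :
  Normc.normc (x - z) <= Normc.normc (x - y) + Normc.normc (y - z).
Proof.
have -> : x - z = (x - y) + (y - z) by ring.
exact: le_normcD.
Qed.

Lemma normc_distC (R : realType) (x y : R[i]) :
  Normc.normc (x - y) = Normc.normc (y - x).
Proof. by rewrite -normcN opprB. Qed.

Lemma normc_gt0 (R : realType) (z : R[i]) : z != 0 -> 0 < Normc.normc z.
Proof.
by move=> z0; rewrite lt_def normc_nneg andbT; apply: contra z0 => /eqP/Normc.eq0_normc ->.
Qed.

(* The compact group operation is coordinatewise multiplication, written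
   additively. *)
Definition torus (R : realType) (J : nat) : Type :=
  {v : {ffun 'I_J -> R[i]} | [forall j, Normc.normc (v j) == 1]}.

HB.instance Definition _ (R : realType) (J : nat) := Choice.on (torus R J).

Definition torus_coord (R : realType) (J : nat) (v : torus R J) (j : 'I_J) : R[i] :=
  sval v j.

Lemma torus_coord_norm (R : realType) (J : nat) (v : torus R J) (j : 'I_J) :
  Normc.normc (torus_coord v j) = 1.
Proof. by case: v => v H; apply/eqP; exact: (forallP H j). Qed.

Lemma torusP (R : realType) (J : nat) (v w : torus R J) :
  torus_coord v =1 torus_coord w -> v = w.
Proof. by move=> vw; apply: val_inj; apply/ffunP. Qed.

Definition torus_of (R : realType) (J : nat) (F : 'I_J -> R[i])
    (F1 : forall j, Normc.normc (F j) = 1) : torus R J :=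
  exist _ [ffun j => F j]
    (introT forallP (fun j => introT eqP (etrans (congr1 _ (ffunE _ j)) (F1 j)))).

Lemma torus_ofE (R : realType) (J : nat) (F : 'I_J -> R[i])
    (F1 : forall j, Normc.normc (F j) = 1) (j : 'I_J) :
  torus_coord (torus_of F1) j = F j.
Proof. exact: ffunE. Qed.

Lemma torus_add_norm (R : realType) (J : nat) (v w : torus R J) (j : 'I_J) :
  Normc.normc (torus_coord v j * torus_coord w j) = 1.
Proof. by rewrite Normc.normcM !torus_coord_norm mulr1. Qed.

Lemma torus_opp_norm (R : realType) (J : nat) (v : torus R J) (j : 'I_J) :
  Normc.normc (torus_coord v j)^-1 = 1.
Proof. by rewrite Normc.normcV torus_coord_norm invr1. Qed.

(** The index [j] gives the statement the shape of a family, as [torus_of] expects. *)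
Lemma torus_zero_norm (R : realType) (J : nat) (j : 'I_J) :
  Normc.normc (1 : R[i]) = 1.
Proof. exact: Normc.normc1. Qed.

Definition torus_add (R : realType) (J : nat) (v w : torus R J) : torus R J :=
  torus_of (torus_add_norm v w).
Definition torus_opp (R : realType) (J : nat) (v : torus R J) : torus R J :=
  torus_of (torus_opp_norm v).
Definition torus_zero (R : realType) (J : nat) : torus R J :=
  torus_of (@torus_zero_norm R J).

Lemma torus_addA (R : realType) (J : nat) : associative (@torus_add R J).
Proof. by move=> u v w; apply: torusP => j; rewrite !torus_ofE mulrA. Qed.

Lemma torus_addC (R : realType) (J : nat) : commutative (@torus_add R J).
Proof. by move=> u v; apply: torusP => j; rewrite !torus_ofE mulrC. Qed.

Lemma torus_add0 (R : realType) (J : nat) : left_id (torus_zero R J) (@torus_add R J).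
Proof. by move=> u; apply: torusP => j; rewrite !torus_ofE mul1r. Qed.

Lemma torus_addN (R : realType) (J : nat) :
  left_inverse (torus_zero R J) (@torus_opp R J) (@torus_add R J).
Proof.
move=> u; apply: torusP => j; rewrite !torus_ofE mulVf //.
by apply: contra_eq_neq (torus_coord_norm u j) => ->; rewrite Normc.normc0 eq_sym oner_neq0.
Qed.

HB.instance Definition _ (R : realType) (J : nat) :=
  GRing.isZmodule.Build (torus R J) (@torus_addA R J) (@torus_addC R J)
    (@torus_add0 R J) (@torus_addN R J).

Lemma torus_coordD (R : realType) (J : nat) (v w : torus R J) (j : 'I_J) :
  torus_coord (v + w) j = torus_coord v j * torus_coord w j.
Proof. exact: torus_ofE. Qed.

Lemma torus_coord0 (R : realType) (J : nat) (j : 'I_J) :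
  torus_coord (0 : torus R J) j = 1.
Proof. exact: torus_ofE. Qed.

(** * The invariant metric of the torus and its compact group topology *)

Definition torus_dist (R : realType) (J : nat) (v w : torus R J) : R :=
  \sum_j Normc.normc (torus_coord v j - torus_coord w j).

Lemma torus_distxx (R : realType) (J : nat) (v : torus R J) : torus_dist v v = 0.
Proof. by rewrite /torus_dist big1 // => j _; rewrite subrr Normc.normc0. Qed.

Lemma torus_coord_dist (R : realType) (J : nat) (v w : torus R J) (j : 'I_J) :
  Normc.normc (torus_coord v j - torus_coord w j) <= torus_dist v w.
Proof.
rewrite /torus_dist (bigD1 j) //= lerDl sumr_ge0 // => i _; exact: normc_nneg.
Qed.

Lemma torus_dist_eq0 (R : realType) (J : nat) (v w : torus R J) :
  torus_dist v w = 0 -> v = w.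
Proof.
move=> d0; apply: torusP => j; apply/eqP; rewrite -subr_eq0; apply/eqP.
apply: Normc.eq0_normc; apply/eqP; rewrite eq_le normc_nneg andbT -d0.
exact: torus_coord_dist.
Qed.

Lemma torus_distC (R : realType) (J : nat) (v w : torus R J) :
  torus_dist v w = torus_dist w v.
Proof. by apply: eq_bigr => j _; rewrite normc_distC. Qed.

Lemma torus_dist_triangle (R : realType) (J : nat) (w v u : torus R J) :
  torus_dist v u <= torus_dist v w + torus_dist w u.
Proof. by rewrite -big_split; apply: ler_sum => j _; exact: normc_dist_triangle. Qed.

HB.instance Definition _ (R : realType) (J : nat) :=
  isMetric.Build R (torus R J) (@torus_distxx R J) (@torus_dist_eq0 R J)
    (@torus_distC R J) (@torus_dist_triangle R J).

Lemma torus_ballP (R : realType) (J : nat) (v w : torus R J) (e : R) :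
  ball v e w <-> torus_dist v w < e.
Proof. by []. Qed.

Lemma torus_dist_translate (R : realType) (J : nat) (u v w : torus R J) :
  torus_dist (u + v) (u + w) = torus_dist v w.
Proof.
apply: eq_bigr => j _.
by rewrite !torus_coordD -mulrBr Normc.normcM torus_coord_norm mul1r.
Qed.

(** Translation by [v + w] carries [- v] and [- w] to [w] and [v]. *)
Lemma torus_dist_opp (R : realType) (J : nat) (v w : torus R J) :
  torus_dist (- v) (- w) = torus_dist v w.
Proof.
rewrite -(torus_dist_translate (v + w)) torus_distC.
by rewrite addrK addrAC subrr add0r.
Qed.

Lemma torus_add_continuous (R : realType) (J : nat) :
  continuous (fun x : torus R J * torus R J => x.1 + x.2).
Proof.
move=> [x y]; apply/cvg_ballP => e e0.
have e2 : 0 < e / 2 by exact: divr_gt0.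
exists (ball x (e / 2), ball y (e / 2)); first by split; exact: nbhsx_ballx.
move=> [x' y'] [/= bx by_]; apply/torus_ballP.
apply: (le_lt_trans (torus_dist_triangle (x + y') _ _)).
rewrite torus_dist_translate ![_ + y']addrC torus_dist_translate.
by rewrite [e]splitr addrC ltrD.
Qed.

Lemma torus_opp_continuous (R : realType) (J : nat) :
  continuous (-%R : torus R J -> torus R J).
Proof.
move=> x A /nbhs_ballP[e /= e0 eA]; apply/nbhs_ballP; exists e => // y xy.
by apply: eA; apply/torus_ballP; rewrite torus_dist_opp.
Qed.

HB.instance Definition _ (R : realType) (J : nat) :=
  PreTopologicalNmodule_isTopologicalNmodule.Build (torus R J)
    (@torus_add_continuous R J).
HB.instance Definition _ (R : realType) (J : nat) :=
  TopologicalNmodule_isTopologicalZmodule.Build (torus R J)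
    (@torus_opp_continuous R J).

Lemma torus_metrizable (R : realType) (J : nat) : metrizable R (torus R J).
Proof.
exists (@torus_dist R J); split.
  by move=> x y; split=> [/torus_dist_eq0|->] //; exact: torus_distxx.
split; first exact: torus_distC.
split; first by move=> x y z; exact: torus_dist_triangle.
move=> A; split=> [oA x Ax|HA].
  by have /nbhs_ballP[e /= e0 eA] := open_nbhs_nbhs (conj oA Ax); exists e.
by rewrite openE => x /HA[e e0 eA]; apply/nbhs_ballP; exists e.
Qed.

(** An ultrafilter converges coordinate by coordinate, and the limits again have modulus 1. *)
Lemma torus_compact (R : realType) (J : nat) : compact [set: torus R J].
Proof.
rewrite compact_ultra => F FU _; have FF : ProperFilter F by exact: ultra_proper.
have lim (j : 'I_J) : exists z, forall e, 0 < e ->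
    F [set v | Normc.normc (torus_coord v j - z) < e].
  apply: (@ultra_climit R _ F (fun v => torus_coord v j) 1 setT) => //.
    exact: filterT.
  by move=> v _; rewrite torus_coord_norm.
have {lim} [z Hz] := choice lim.
have z1 j : Normc.normc (z j) = 1.
  apply/eqP; rewrite eq_le; apply/andP; split; apply/ler_addgt0Pr => e e0.
    have [v /= Hv] := filter_ex (Hz j e e0).
    have := normc_dist_triangle (z j) (torus_coord v j) 0.
    rewrite !subr0 torus_coord_norm normc_distC => H.
    by apply: (le_trans H); rewrite addrC lerD2l ltW.
  have [v /= Hv] := filter_ex (Hz j e e0).
  have := normc_dist_triangle (torus_coord v j) (z j) 0.
  rewrite !subr0 torus_coord_norm => H.
  by apply: (le_trans H); rewrite addrC lerD2l ltW.
exists (torus_of z1); split => //; apply/fcvg_ballP => e e0.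
(* Dividing by [J.+1] rather than [J] covers [J = 0] and keeps the sum of the [J] errors strictly
   below [e]. *)
have eJ : 0 < e / J.+1%:R by exact: divr_gt0.
have HF : F [set v | forall j, Normc.normc (torus_coord v j - z j) < e / J.+1%:R].
  by apply: filter_forall => j; exact: Hz.
suff : F (ball (torus_of z1) e) by [].
apply: filterS HF => v /= Hv.
apply/torus_ballP; apply: (@le_lt_trans _ _ (\sum_(j < J) e / J.+1%:R)).
  by apply: ler_sum => j _; rewrite torus_ofE normc_distC ltW.
by rewrite sumr_const card_ord -[_ *+ J]mulr_natr mulrAC ltr_pdivrMr // ltr_pM2l // ltr_nat.
Qed.

(** * Bohr sets of rotations *)

Lemma torus_coord_near (R : realType) (J : nat) (v : torus R J) (j : 'I_J) (e : R) :
  0 < e -> \forall w \near v, Normc.normc (torus_coord v j - torus_coord w j) < e.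
Proof.
move=> e0; apply/nbhs_ballP; exists e => // w /torus_ballP.
exact/le_lt_trans/torus_coord_dist.
Qed.

(** Boundaries of the basic Bohr neighbourhoods will be covered by finitely many such slices. *)
Definition torus_slice (R : realType) (J : nat) (j : 'I_J) (z : R[i]) : set (torus R J) :=
  [set v | torus_coord v j = z].

Lemma closed_torus_slice (R : realType) (J : nat) (j : 'I_J) (z : R[i]) :
  closed (@torus_slice R J j z).
Proof.
move=> v cv; apply: contrapT => /eqP; rewrite -subr_eq0 => /normc_gt0 e0.
have [w [/= wz]] := cv _ (torus_coord_near v j e0).
by rewrite wz ltxx.
Qed.

Lemma measurable_closed_openK (K : topologicalZmodType) (A : set K) :
  closed A -> @measurable _ (g_sigma_algebraType (@openK K)) A.
Proof.
move=> cA; rewrite -[A]setCK; apply: measurableC.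
by apply: sub_sigma_algebra; rewrite /openK /=; exact: closed_openC.
Qed.

(* [t m = (1 + m i) / (1 - m i)] *)
Lemma unit_sequence (R : realType) : exists t : nat -> R[i],
  injective t /\ forall m, Normc.normc (t m) = 1.
Proof.
have D (m : nat) : 0 < 1 + m%:R ^+ 2 :> R by rewrite ltr_pwDl // sqr_ge0.
exists (fun m => Complex ((1 - m%:R ^+ 2) / (1 + m%:R ^+ 2)) (2 * m%:R / (1 + m%:R ^+ 2))).
split=> [m n [+ _]|m].
  move=> /eqP; rewrite eqr_div ?lt0r_neq0 // => /eqP H.
  have {}H : (m%:R ^+ 2 : R) = n%:R ^+ 2 by lra.
  apply/eqP; rewrite -(eqr_nat R) -(eqrXn2 (n := 2)) //; exact/eqP.
apply/eqP; rewrite -(eqrXn2 (n := 2)) // ?normc_nneg // normc_sqr /=; apply/eqP.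
by field; exact: lt0r_neq0.
Qed.

(* The rotates of a slice by infinitely many angles are disjoint and have equal measure. *)
Lemma torus_slice_null (R : realType) (J : nat) (j : 'I_J) (z : R[i])
    (mu : probability (g_sigma_algebraType (@openK (torus R J))) R) :
  (forall (x : torus R J) (A : set (g_sigma_algebraType (@openK (torus R J)))),
     measurable A -> mu [set (x + (y : torus R J)) | y in A] = mu A) ->
  Normc.normc z = 1 -> mu (@torus_slice R J j z) = 0%E.
Proof.
move=> inv z1; have [t [tinj t1]] := unit_sequence R.
(* The group element used for translation rotates coordinate [j] by [w] and fixes the others. *)
have rn (w : R[i]) : Normc.normc w = 1 ->
    forall i : 'I_J, Normc.normc (if i == j then w else 1) = 1.
  by move=> w1 i; case: ifP => // _; exact: Normc.normc1.
have mS w : @measurable _ (g_sigma_algebraType (@openK (torus R J))) (@torus_slice R J j w).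
  exact: (@measurable_closed_openK (torus R J) _ (@closed_torus_slice R J j _)).
have muE m : mu (@torus_slice R J j (t m * z)) = mu (@torus_slice R J j z).
  rewrite -[RHS](inv (torus_of (rn _ (t1 m)))) //; congr (mu _).
  apply/seteqP; split=> [v /= vt|_ [v /= vz <-]]; last first.
    by rewrite /torus_slice /= torus_coordD torus_ofE eqxx vz.
  exists (- torus_of (rn _ (t1 m)) + v); last by rewrite addrA subrr add0r.
  rewrite /torus_slice /= torus_coordD vt [torus_coord (- _) j]torus_ofE torus_ofE eqxx.
  rewrite mulrA mulVf ?mul1r //.
  by apply: contra_eq_neq (t1 m) => ->; rewrite Normc.normc0 eq_sym oner_neq0.
pose F m : set (g_sigma_algebraType (@openK (torus R J))) := @torus_slice R J j (t m * z).
have tF : trivIset setT F.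
  move=> m n _ _ [v [vm vn]]; apply: tinj.
  have z0 : z != 0 by apply: contra_eq_neq z1 => ->; rewrite Normc.normc0 eq_sym oner_neq0.
  by apply: (mulIf z0); rewrite -vm -vn.
have fin : mu (@torus_slice R J j z) \is a fin_num by exact: fin_num_measure.
rewrite -(fineK fin); congr (_%:E).
set c := fine _.
have c0 : 0 <= c by exact: fine_ge0.
have le1 n : c *+ n <= 1.
  rewrite -lee_fin.
  have : (\sum_(i < n) mu (F i) <= 1)%E.
    rewrite -(@measure_bigsetU _ _ _ mu F) //; last by move=> m; exact: mS.
    by apply: probability_le1; apply: bigsetU_measurable => i _; exact: mS.
  by rewrite (eq_bigr (fun=> c%:E)) => [|i _]; rewrite ?sumEFin ?sumr_const ?card_ord // /F muE fineK.
apply/eqP; rewrite eq_le c0 andbT leNgt; apply/negP => cp.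
(* A number of slices larger than [1 / c] would have total measure above 1. *)
have := le1 (Num.truncn c^-1).+1.
rewrite leNgt => /negP; apply; rewrite -mulr_natr mulrC -ltr_pdivrMr // mul1r.
exact: truncnS_gt.
Qed.

(** The set is the preimage of an open box [U] in the torus. At a boundary point some coordinate
    lies at distance exactly [d] from 1, and the unit circle has at most two such points, so the
    boundary sits in finitely many null slices. *)
Lemma bohr0_rotations (R : realType) (J : nat) (theta : 'I_J -> R) (d : R) : 0 < d ->
  bohr0 R [set m : nat | forall j, Normc.normc (cexp2pi (theta j * m%:R) - 1) < d].
Proof.
move=> d0.
have cn (m : nat) j : Normc.normc (cexp2pi (theta j * m%:R)) = 1.
  by apply/eqP; rewrite -(eqrXn2 (n := 2)) // ?normc_nneg // normc_sqr /= cos2Dsin2 expr1n.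
pose a (m : nat) : torus R J := torus_of (cn m).
pose U : set (torus R J) := [set v | forall j, Normc.normc (torus_coord v j - 1) < d].
have oU : open U.
  rewrite openE => v Uv.
  suff : nbhs v [set w | forall j, Normc.normc (torus_coord w j - 1) < d] by [].
  have FF : Filter (nbhs v) by exact: nbhs_filter.
  apply: (@filter_forall _ _ (fun j w => Normc.normc (torus_coord w j - 1) < d) _ FF) => j.
  have e0 : 0 < d - Normc.normc (torus_coord v j - 1) by rewrite subr_gt0.
  apply: filterS (torus_coord_near v j e0) => w vw.
  by rewrite (le_lt_trans (normc_dist_triangle _ (torus_coord v j) _)) // -ltrBrDr normc_distC.
have cU v : closure U v -> forall j, Normc.normc (torus_coord v j - 1) <= d.
  move=> cv j; rewrite leNgt; apply/negP; rewrite -subr_gt0 => e0.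
  have [w [Uw /= vw]] := cv _ (torus_coord_near v j e0).
  have := normc_dist_triangle (torus_coord v j) (torus_coord w j) 1.
  have := Uw j; lra.
exists (torus R J), a, U; split.
- by split; [exact: torus_compact|exact: torus_metrizable].
- move=> m n; apply: torusP => j; rewrite torus_coordD !torus_ofE /cexp2pi natrD.
  rewrite !mulrDr cosD sinD; congr Complex; ring.
- by split=> // j; rewrite torus_coord0 subrr Normc.normc0.
- move=> mu inv.
  (* Subtracting [|z - 1|^2 = d^2] from [|z|^2 = 1] gives the real part [c], hence the imaginary
     part [s] or [- s]. For [d > 2] the root is 0 and the point lies off the unit circle, so its
     slice is empty. *)
  pose c : R := 1 - d ^+ 2 / 2; pose s := Num.sqrt (1 - c ^+ 2).
  pose Z := \big[setU/set0]_(j < J)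
    (torus_slice j (Complex c s) `|` torus_slice j (Complex c (- s)) : set (torus R J)).
  have slice0 (j : 'I_J) z : mu.-negligible (torus_slice j z : set (torus R J)).
    have mS : @measurable _ (g_sigma_algebraType (@openK (torus R J))) (@torus_slice R J j z).
      exact: (@measurable_closed_openK (torus R J) _ (@closed_torus_slice R J j _)).
    have [z1|z1] := eqVneq (Normc.normc z) 1.
      exists (torus_slice j z); split => //; exact: torus_slice_null.
    suff -> : torus_slice j z = set0 by exact: negligible_set0.
    apply/seteqP; split=> v //= vz; move: z1; rewrite -vz torus_coord_norm eqxx.
    by [].
  have Z0 : mu.-negligible Z.
    by rewrite /Z; elim/big_ind: _ => [|A B nA nB|j _];
       [exact: negligible_set0|exact: negligibleU|exact: negligibleU].
  apply: measure_negligible.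
    apply: measurableD; first exact: (@measurable_closed_openK (torus R J) _ (@closed_closure _ U)).
    by apply: sub_sigma_algebra; exact: open_interior.
  apply: negligibleS Z0 => v [cv nI].
  have nU : ~ U v by move=> Uv; apply: nI; move: oU; rewrite openE => /(_ v Uv).
  have [j nj] : exists j, ~ Normc.normc (torus_coord v j - 1) < d by exact/existsNP.
  have vd : Normc.normc (torus_coord v j - 1) = d.
    by apply/eqP; rewrite eq_le cU //= leNgt; exact/negP.
  rewrite /Z (bigD1 j) //=; left.
  have H1 : Normc.normc (torus_coord v j - 1) ^+ 2 = d ^+ 2 by rewrite vd.
  have H2 : Normc.normc (torus_coord v j) ^+ 2 = 1 by rewrite torus_coord_norm expr1n.
  move: H1 H2; rewrite !normc_sqr /torus_slice /=.
  case: (torus_coord v j) => x y /= H1 H2.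
  have xc : x = c by rewrite /c -H1; lra.
  have : s ^+ 2 = y ^+ 2.
    have -> : y ^+ 2 = 1 - c ^+ 2 by rewrite -xc; lra.
    rewrite sqr_sqrtr // -xc; have := sqr_ge0 y; lra.
  move=> /eqP; rewrite eqf_sqr => /orP[/eqP sy|/eqP sy]; [left|right].
    by rewrite xc sy.
  by rewrite xc sy opprK.
- by apply/seteqP; split=> m /= H j; have := H j; rewrite torus_ofE.
Qed.

(** * Measures on the space of ultrafilters *)

Lemma besnormE_lt (R : realType) (Psi : nat -> {fset nat}) (h : nat -> \bar R) (C e : R) :
  0 < e -> 0 <= C -> C < e ^+ 2 ->
  (\forall N \near \oo, (avgE Psi h N <= C%:E)%E) -> (besnormE Psi h < e%:E)%E.
Proof.
move=> e0 C0 Ce hC; apply: (@le_lt_trans _ _ (sqrte C%:E)).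
  rewrite lee_sqrt ?lee_fin //; apply: ge_ereal_inf.
  exists (ereal_sup (avgE Psi h @` [set N | (avgE Psi h N <= C%:E)%E])).
    by exists [set N | (avgE Psi h N <= C%:E)%E].
  by apply: ge_ereal_sup => _ [N /= ? <-].
by rewrite /= lte_fin -(ger0_norm (ltW e0)) -sqrtr_sqr ltr_sqrt // exprn_gt0.
Qed.

(** The upper limit is an infimum of suprema over eventual sets, so a strict bound on it holds for
    all large [N]. *)
Lemma Bes_approx (R : realType) (Phi : nat -> {fset nat}) (f : nat -> R[i]) (k : R) :
  Bes Phi f -> 0 < k -> exists2 P, trigpoly P &
  \forall N \near \oo, avg (Phi N) (fun n => Normc.normc (f n - P n) ^+ 2) < k.
Proof.
move=> fB k0; have [|P [tP fP]] := fB (Num.sqrt k); first by rewrite sqrtr_gt0.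
exists P => //.
have : (limn_esup (avgE Phi (sqmod (fun n => (f n - P n)%R))) < k%:E)%E.
  rewrite ltNge; apply/negP => kl; move: fP; rewrite ltNge => /negP; apply.
  have -> : (Num.sqrt k)%:E = sqrte k%:E by [].
  by rewrite lee_sqrt //; apply: le_trans kl; rewrite lee_fin ltW.
move=> /ereal_inf_lt[_ [V NV <-] Vk].
apply: (@filterS _ \oo _ V) => // N VN.
rewrite -lte_fin; apply: le_lt_trans Vk.
apply: ereal_sup_ubound; exists N => //.
by rewrite /avgE /avg EFinM -sumEFin.
Qed.

Lemma bopen_cl (A : set nat) : bopen (cl A).
Proof. by move=> p pA; exists A; split. Qed.

Lemma measurable_cl (A : set nat) : measurable (cl A : set BN).
Proof. apply: sub_sigma_algebra; exact: bopen_cl. Qed.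

(** An ultrafilter contains [A] or its complement, so [cl A] is clopen and its indicator may serve
    as a weak-star test function. *)
Lemma bcontinuous_indic_cl (R : realType) (A : set nat) :
  bcontinuous (\1_(cl A) : betaN -> R).
Proof.
move=> V _ p; rewrite /= indicE => Vp.
have pU : UltraFilter (proj1_sig p) by case: p {Vp}.
have [pA|pA] := in_ultra_setVsetC A pU.
  exists A; split=> // q qA; move: Vp; rewrite /= indicE.
  by rewrite (mem_set (pA : cl A p)) (mem_set qA).
have disj (q : betaN) : proj1_sig q (~` A) -> (q \in cl A) = false.
  case: q => q qU /= qC; apply/negP => /set_mem /= qA.
  have qP : ProperFilter q by apply: ultra_proper.
  by have [n []] := filter_ex (filterI qA qC).
exists (~` A); split=> // q /= qA; rewrite /= indicE disj //.
by move: Vp; rewrite disj.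
Qed.

(** The indicator of [cl A] at the principal ultrafilter of [n] equals that of [A] at [n], so the
    empirical averages are densities of [A], and a cluster point inherits their eventual bound. *)
Lemma inM_cl_le (R : realType) (Psi : nat -> {fset nat}) (mu : probability BN R)
    (A : set nat) (c : R) : inM Psi mu ->
  (\forall M \near \oo, avg (Psi M) \1_A <= c) -> (mu (cl A) <= c%:E)%E.
Proof.
move=> [_ wc] [K _ HK]; apply/lee_addgt0Pr => e e0.
have [//|N [KN /(_ 0%N isT)]] := wc 1%N (fun=> \1_(cl A)) e _ e0 K.
  by move=> i _; exact: bcontinuous_indic_cl.
have -> : emp_avg Psi N (\1_(cl A)) = avg (Psi N) (\1_A : nat -> R).
  congr (_ * _); apply: eq_bigr => n _; rewrite !indicE.
  congr (nat_of_bool _)%:R; apply/idP/idP => /set_mem H; apply/mem_set.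
    exact/(principal_filterP n A).
  exact/(principal_filterP n A).
have fin : mu (cl A) \is a fin_num by apply: fin_num_measure; exact: measurable_cl.
have -> : (\int[mu]_x (\1_(cl A) x)%:E = (fine (mu (cl A)))%:E)%E.
  by rewrite integral_indic ?setIT ?fineK //; exact: measurable_cl.
rewrite -(fineK fin) -EFinB -EFinD lte_fin lee_fin ltr_norml => /andP[H _].
have := HK N KN; lra.
Qed.

(** * Choice of subsequences, Bohr sets of almost periods, and the final estimate *)

Lemma strict_subsequence (G : nat -> nat -> Prop) :
  (forall N, \forall M \near \oo, G N M) ->
  exists s : nat -> nat, (forall N, (s N < s N.+1)%N) /\ forall N, G N (s N).
Proof.
move=> HG; have /choice[T HT] : forall N, exists K, forall M, (K <= M)%N -> G N M.
  by move=> N; have [K _ HK] := HG N; exists K.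
pose s := fix s N := if N is N'.+1 then maxn (s N').+1 (T N'.+1) else T 0%N.
exists s; split; first by move=> N /=; exact: leq_maxl.
by case=> [|N]; apply: HT => //=; exact: leq_maxr.
Qed.

Lemma strict_subsequence_ge (s : nat -> nat) :
  (forall N, (s N < s N.+1)%N) -> forall N, (N <= s N)%N.
Proof. by move=> sS; elim=> // N /leq_ltn_trans; apply. Qed.

(** Shifting by [m] multiplies the [j]-th exponential by [cexp2pi (th j * m%:R)]; if all these
    factors are close to 1, the change in [Q] is small uniformly in [n]. *)
Lemma trigpoly_bohr (R : realType) (Q : nat -> R[i]) (eta : R) :
  trigpoly Q -> 0 < eta -> exists2 B, bohr0 R B &
  forall m, B m -> forall n, Normc.normc (Q (n + m)%N - Q n) ^+ 2 <= eta.
Proof.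
move=> [J [c [th [_ QE]]]] eta0.
pose S := \sum_(j < J) Normc.normc (c j).
have S0 : 0 <= S by apply: sumr_ge0 => j _; exact: normc_nneg.
have r0 : 0 < Num.sqrt eta by rewrite sqrtr_gt0.
(* The tolerance times the coefficient sum [S] is at most [sqrt eta]; adding 1 allows [S = 0]. *)
have d0 : 0 < Num.sqrt eta / (S + 1) by rewrite divr_gt0 // ltr_wpDl.
exists [set m : nat | forall j : 'I_J, Normc.normc (cexp2pi (th j * m%:R) - 1) <
   Num.sqrt eta / (S + 1)]; first exact: bohr0_rotations.
move=> m Hm n.
suff H : Normc.normc (Q (n + m)%N - Q n) <= Num.sqrt eta.
  by rewrite -[leRHS](sqr_sqrtr (ltW eta0)) lerXn2r // nnegrE ?normc_nneg ?sqrtr_ge0.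
have cexpD (x y : R) : cexp2pi (x + y) = cexp2pi x * cexp2pi y.
  by rewrite /cexp2pi !mulrDr cosD sinD; congr Complex; ring.
have cexp1 (x : R) : Normc.normc (cexp2pi x) = 1.
  by apply/eqP; rewrite -(eqrXn2 (n := 2)) // ?normc_nneg // normc_sqr /= cos2Dsin2 expr1n.
have -> : Q (n + m)%N - Q n =
    \sum_(j < J) c j * cexp2pi (th j * n%:R) * (cexp2pi (th j * m%:R) - 1).
  rewrite !QE -sumrB; apply: eq_bigr => j _.
  by rewrite natrD mulrDr cexpD; ring.
apply: (@le_trans _ _ (\sum_(j < J) Normc.normc (c j) * (Num.sqrt eta / (S + 1)))).
  elim/big_ind2: _ => [|x y u v Hx Hy|j _]; first by rewrite Normc.normc0.
    by apply: (le_trans (le_normcD _ _)); exact: lerD.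
  by rewrite !Normc.normcM cexp1 mulr1 ler_wpM2l ?normc_nneg //; exact: ltW (Hm j).
rewrite -mulr_suml -/S mulrCA ger_pMr // ler_pdivrMr ?ltr_wpDl // mul1r.
by rewrite lerDl.
Qed.

Lemma normc_sqrD4 (R : realType) (a b c d : R[i]) :
  Normc.normc (a + b + (c + d)) ^+ 2 <= 4 * (Normc.normc a ^+ 2 +
    Normc.normc b ^+ 2 + Normc.normc c ^+ 2 + Normc.normc d ^+ 2).
Proof.
have := normc_sqrD2 (a + b) (c + d); have := normc_sqrD2 a b.
have := normc_sqrD2 c d; lra.
Qed.

Theorem theorem4p10 (R : realType) (Phi : nat -> {fset nat}) (f : nat -> R[i]) :
  folner R Phi -> Bes Phi f ->
  forall e : R, 0 < e ->
  exists (B : set nat) (sigma : nat -> nat),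
    bohr0 R B /\
    (forall k, (sigma k < sigma k.+1)%N) /\
    forall mu : probability BN R, inM (Phi \o sigma) mu ->
      mu.-negligible
        [set p : BN | cl B p /\ ~ (besnorm_Rp_sub (Phi \o sigma) p f < e%:E)%E].
Proof.
move=> Fo fB e e0.
(* The final bound on the averages is [3 * 32 * eta = 96 * eta], strictly below [e ^+ 2]. *)
pose eta := e ^+ 2 / 100.
have eta0 : 0 < eta by rewrite divr_gt0 // exprn_gt0.
(* Chosen so that the Markov bound [2 * kap N / eta] is exactly [1 / 2 ^ N.+1], which is
   summable. *)
pose kap (N : nat) : R := eta / 2 / (2 ^ N.+1)%:R.
have kap0 N : 0 < kap N.
  by apply: divr_gt0; [exact: divr_gt0|rewrite ltr0n expn_gt0].
have kap_eta N : kap N <= eta.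
  rewrite ler_pdivrMr ?ltr0n ?expn_gt0 //.
  have : (1 <= (2 ^ N.+1)%:R :> R) by rewrite ler1n expn_gt0.
  nra.
(* The fixed polynomial [Q] determines one Bohr set for all [N]; the improving [P N] make the
   exceptional sets summable. *)
have [Q tQ fQ] := Bes_approx fB eta0.
have /choice[P HP] : forall N, exists P, trigpoly P /\
    \forall M \near \oo, avg (Phi M) (fun n => Normc.normc (f n - P n) ^+ 2) < kap N.
  by move=> N; have [P tP fP] := Bes_approx fB (kap0 N); exists P.
have [B bB BQ] := trigpoly_bohr tQ eta0.
pose G N M := (forall m, avg (Phi M)
    (fun n => Normc.normc (P N (n + m)%N - Q (n + m)%N) ^+ 2) < 5 * eta) /\
  avg (Phi M) (fun n => Normc.normc (f n - Q n) ^+ 2) < eta.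
have GM N : \forall M \near \oo, G N M.
  have [tP fP] := HP N.
  (* Comparison through [f] gives [2 * kap N + 2 * eta], at most [4 * eta]; passing to all
     translates costs one more [eta]. *)
  have PQ : \forall M \near \oo,
      avg (Phi M) (fun n => Normc.normc (P N n - Q n) ^+ 2) < 4 * eta.
    near=> M.
    apply: (@le_lt_trans _ _ (avg (Phi M) (fun n => 2 * Normc.normc (f n - P N n) ^+ 2
                                              + 2 * Normc.normc (f n - Q n) ^+ 2))).
      apply: ler_avg => n _; rewrite -mulrDr.
      have -> : P N n - Q n = - (f n - P N n) + (f n - Q n) by ring.
      by apply: (le_trans (normc_sqrD2 _ _)); rewrite normcN.
    rewrite avgD !avgZ.
    have h1 : avg (Phi M) (fun n => Normc.normc (f n - P N n) ^+ 2) < kap N by near: M.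
    have h2 : avg (Phi M) (fun n => Normc.normc (f n - Q n) ^+ 2) < eta by near: M.
    have := kap_eta N; lra.
  have := rtrig_avg_shift_lt Fo (trigpoly_sub_rtrig tP tQ) PQ eta0.
  have -> : 4 * eta + eta = 5 * eta by ring.
  by move=> H; near=> M; split; near: M.
have [s [sS Gs]] := strict_subsequence GM.
exists B, s; split => //; split => // mu muM.
pose A N := [set m | eta < avg (Phi (s N))
                 (fun n => Normc.normc (f (n + m)%N - P N (n + m)%N) ^+ 2)].
have Phi0 N : Phi N != fset0 by case: Fo.
have muA N : (mu (cl (A N)) <= (1 / (2 ^ N.+1)%:R)%:E)%E.
  apply: (inM_cl_le muM).
  have [_ fP] := HP N.
  have [K _ HK] := @superlevel_density _ _ (fun n => Normc.normc (f n - P N n) ^+ 2) _ _ _ Fo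
    (fun n => sqr_ge0 _) (Phi0 (s N)) eta0 (kap0 N) fP.
  (* The density bound was obtained along [Phi]; it passes to the subsequence because [M <= s M]. *)
  exists K => // M KM; apply: le_trans (HK (s M) _) _.
    exact: leq_trans KM (strict_subsequence_ge sS M).
  suff -> : 2 * kap N / eta = 1 / (2 ^ N.+1)%:R by [].
  by rewrite /kap; field; rewrite ?gt_eqF // ltr0n expn_gt0.
(* Borel-Cantelli: the measures of the [cl (A N)] have sum at most 1. *)
have lim0 : mu (lim_sup_set (fun N => cl (A N) : set BN)) = 0%E.
  apply: lim_sup_set_cvg0 => [N|]; first exact: measurable_cl.
  apply: (@le_lt_trans _ _ (\sum_(N <oo) (1 / (2 ^ N.+1)%:R)%:E)%E).
    by apply: lee_nneseries => [N _ _|N _]; [exact: measure_ge0|exact: muA].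
  by apply: le_lt_trans (epsilon_trick0 _ _) _; [|exact: ltry].
exists (lim_sup_set (fun N => cl (A N) : set BN)); split => //.
  apply: bigcap_measurable => // k _; apply: bigcup_measurable => j _.
  exact: measurable_cl.
(* If [p] avoids every [cl (A N)] with [N >= K], the seminorm is shown to be below [e], contrary to
   the choice of [p]. *)
move=> p [pB nb] K _; apply: contrapT => nA; apply: nb.
have pU : UltraFilter (proj1_sig p) by case: p {pB nA}.
have pP : ProperFilter (proj1_sig p) by exact: ultra_proper.
have pA N : (K <= N)%N -> proj1_sig p (~` A N).
  move=> KN; have [pA|//] := in_ultra_setVsetC (A N) pU.
  by exfalso; apply: nA; exists N.
apply: (@besnormE_lt _ _ _ (3 * (32 * eta))) => //.
- by rewrite !mulr_ge0 // ltW.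
- by rewrite /eta; have := exprn_gt0 2 e0; lra.
exists K => // N KN.
apply: (@avgE_Rp_sub_le _ _ _ _ _ (32 * eta) (B `&` ~` A N)) => //.
- exact: Phi0.
- by rewrite mulr_gt0.
- exact: filterI pB (pA N KN).
move=> m [Bm nAm].
have {}nAm : avg (Phi (s N))
    (fun n => Normc.normc (f (n + m)%N - P N (n + m)%N) ^+ 2) <= eta.
  by rewrite leNgt; apply/negP.
have [G1 G2] := Gs N.
(* The four differences contribute at most [eta], [5 * eta], [eta] and [eta], and the factor 4
   yields [32 * eta]. *)
apply: (@le_trans _ _ (avg (Phi (s N)) (fun n =>
   4 * (Normc.normc (f (n + m)%N - P N (n + m)%N) ^+ 2 +
        Normc.normc (P N (n + m)%N - Q (n + m)%N) ^+ 2 + eta +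
        Normc.normc (f n - Q n) ^+ 2)))).
  apply: ler_avg => n _.
  have -> : f (n + m)%N - f n = (f (n + m)%N - P N (n + m)%N) + (P N (n + m)%N - Q (n + m)%N)
    + ((Q (n + m)%N - Q n) + - (f n - Q n)) by ring.
  apply: (le_trans (normc_sqrD4 _ _ _ _)).
  by rewrite ler_pM2l // normcN lerD2r lerD2l BQ.
rewrite avgZ !avgD avg_cst //.
have := G1 m; lra.
Unshelve. all: by end_near. Qed.
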